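(* Let $\mu\in\mathcal P$ and $n\in\mathbb N$. For every $p\in\Pi_n$ there exists a best $d_{\sf K}$-approximation of $\mu$, given $p$. Moreover, for $x\in\Xi_n$, the measure $\delta_x^p$ is a best $d_{\sf K}$-approximation of $\mu$, given $p$, if and only if, for every $j=1,\ldots,n$, $$P_{j-1}<P_j\ \Longrightarrow\ F_{\mu-}^{-1}\bigl(P_j-{\sf K}_\bullet(p)\bigr)\le x_j\le F_\mu^{-1}\bigl(P_{j-1}+{\sf K}_\bullet(p)\bigr),$$ and in this case $d_{\sf K}(\mu,\delta_x^p)={\sf K}_\bullet(p)$.
   Context: $\mathbb I\subset\mathbb R$ is a compact interval with positive Lebesgue measure, and $\mathcal P$ is the set of all Borel probability measures on $\mathbb I$. For $\mu\in\mathcal P$, $F_\mu(x)=\mu(\{y\in\mathbb I:y\le x\})$ for $x\in\mathbb R$. The (upper) quantile function is $F_\mu^{-1}:\mathbb R\to\mathbb R\cup\{\pm\infty\}$, $F_\mu^{-1}(t)=\sup\{x\in\mathbb R:F_\mu(x)\le t\}$, with $\sup\varnothing=-\infty$ (so $F_\mu^{-1}(t)=-\infty$ for $t<0$ and $F_\mu^{-1}(t)=+\infty$ for $t\ge1$), and $F_{\mu-}^{-1}(t)=\lim_{\varepsilon\downarrow0}F_\mu^{-1}(t-\varepsilon)$. The Kolmogorov distance is $d_{\sf K}(\mu,\nu)=\sup_{x\in\mathbb R}|F_\mu(x)-F_\nu(x)|$. For $n\in\mathbb N$: $\Xi_n=\{x\in\mathbb I^n:x_1\le\ldots\le x_n\}$;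 $\Pi_n=\{p\in\mathbb R^n:p_j\ge0,\ \sum_{j=1}^np_j=1\}$, with $P_i=\sum_{j=1}^ip_j$ for $i=0,\ldots,n$ (so $P_0=0$, $P_n=1$); $\delta_x^p=\sum_{j=1}^np_j\delta_{x_j}$, where $\delta_a$ is the Dirac measure at $a$. Given $p\in\Pi_n$, $\delta_x^p$ is a best $d_{\sf K}$-approximation of $\mu$, given $p$, if $d_{\sf K}(\mu,\delta_x^p)\le d_{\sf K}(\mu,\delta_y^p)$ for all $y\in\Xi_n$. For $p\in\Pi_n$, $${\sf K}_\bullet(p)=d_{\sf K}\bigl(\mu,\delta_{\xi(p)}^p\bigr),\qquad \xi(p)_j=F_\mu^{-1}\bigl(\tfrac12(P_{j-1}+P_j)\bigr),\quad j=1,\ldots,n,$$ where indices $j$ with $p_j=0$ do not contribute to $\delta_{\xi(p)}^p$ and are disregarded (so the value $\xi(p)_j=+\infty$, which occurs only if $P_{j-1}=P_j=1$, is immaterial). *)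

(* Defs.v *)
(* MathComp-Analysis, over an arbitrary R : realType. *)
From mathcomp Require Export all_boot all_order all_algebra.
From mathcomp Require Export all_classical all_reals all_analysis.
Export numFieldNormedType.Exports.
Export Order.TTheory GRing.Theory Num.Theory.

Set Implicit Arguments.
Unset Strict Implicit.
Unset Printing Implicit Defensive.

Local Open Scope classical_set_scope.
Local Open Scope ring_scope.

(* A Borel probability measure on the compact interval I is represented by a
   Borel probability measure on R that gives I full mass. *)
Definition prob_on (R : realType) (I : set R)
    (mu : probability R R) : Prop :=
  mu I = 1%E.

Definition distrib_fun (R : realType) (I : set R) (m : set R -> \bar R)
    (x : R) : R :=
  fine (m [set y | I y /\ y <= x]).

(* The supremum is taken in \bar R, where ereal_sup set0 = -oo. *)
Definition quantile (R : realType) (I : set R) (m : set R -> \bar R)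
    (t : R) : \bar R :=
  ereal_sup [set x%:E | x in [set x : R | distrib_fun I m x <= t]].

Definition quantile_left (R : realType) (I : set R) (m : set R -> \bar R)
    (t : R) : \bar R :=
  lim (quantile I m (t - e) @[e --> 0^'+]).

Definition dK (R : realType) (I : set R) (m1 m2 : set R -> \bar R) : R :=
  sup (range (fun x : R => `|distrib_fun I m1 x - distrib_fun I m2 x|)).

Definition Xi (R : realType) (I : set R) (n : nat) : set ('I_n -> R) :=
  [set x | (forall j, I (x j)) /\
           (forall i j : 'I_n, (i <= j)%N -> x i <= x j)].

Definition Pi (R : realType) (n : nat) : set ('I_n -> R) :=
  [set p | (forall j, 0 <= p j) /\ \sum_(j < n) p j = 1].

(* Entries of p are indexed from 0: for j : 'I_n, the one-based P_{j-1} and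
   P_j are partial_sum p j and partial_sum p j.+1. *)
Definition partial_sum (R : realType) (n : nat) (p : 'I_n -> R) (i : nat) : R :=
  \sum_(j < n | (j < i)%N) p j.

Definition delta (R : realType) (n : nat) (p x : 'I_n -> R) (A : set R) :
    \bar R :=
  (\sum_(j < n) (p j)%:E * \d_(x j) A)%E.

Definition best_dK_approx (R : realType) (I : set R) (m : set R -> \bar R)
    (n : nat) (p x : 'I_n -> R) : Prop :=
  Xi I x /\
  forall y : 'I_n -> R, Xi I y -> dK I m (delta p x) <= dK I m (delta p y).

(* When 0 < p j the quantile below is finite.  Otherwise its fine value, which
   is 0 if the quantile is infinite, has weight p j = 0 in delta p (xi I m p)
   and is therefore immaterial. *)
Definition xi (R : realType) (I : set R) (m : set R -> \bar R) (n : nat)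
    (p : 'I_n -> R) (j : 'I_n) : R :=
  fine (quantile I m ((partial_sum p j + partial_sum p j.+1) / 2)).

Definition Kbullet (R : realType) (I : set R) (m : set R -> \bar R) (n : nat)
    (p : 'I_n -> R) : R :=
  dK I m (delta p (xi I m p)).

(* Main.v *)
Require Import Defs.
From mathcomp Require Import lra.

(** Write F for the distribution function of mu and G for that of
    delta p x.  Both are nondecreasing, and G is constant between consecutive
    atoms, so G is uniformly within K of F as soon as this is checked at the
    jumps: for every j with 0 < p j, one needs F <= P_{j-1} + K strictly to the
    left of x_j, and F (x_j) >= P_j - K ([dK_delta_le]).  The quantile functions
    are Galois adjoint to F: x <= quantile t says that F <= t to the left of x
    ([le_quantileP]), and quantile_left t <= x says that t <= F x
    ([quantile_left_leP]).  The two jump conditions are therefore exactly the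
    two inequalities of the theorem with K in place of Kbullet
    ([in_bandP]).

    It remains to see that Kbullet is the smallest attainable distance.  If
    some y in Xi is at distance K, compare y_j with the midpoint quantile xi_j.
    At a point between the two, one of the conditions on y_j together with the
    definition of xi_j forces K >= p_j / 2, so that the midpoint of
    [P_{j-1}, P_j] lies in [P_j - K, P_{j-1} + K]; hence xi satisfies the jump
    conditions for the same K ([in_band_quantile]).  Finally xi need not belong
    to Xi at the indices of weight zero, where the quantile may be infinite;
    truncating the quantiles at b repairs this without changing delta
    ([clamped_xi_Xi], [Kbullet_clamped]), and gives the minimizer whose
    existence is claimed. *)

Set Implicit Arguments.
Unset Strict Implicit.
Unset Printing Implicit Defensive.

Local Open Scope classical_set_scope.
Local Open Scope ring_scope.

(** * Distribution functions of Borel probability measures *)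

Lemma distrib_funE (R : realType) (I : set R) (mu : probability R R) (x : R) :
  measurable I -> (distrib_fun I mu x)%:E = mu (I `&` `]-oo, x]).
Proof.
move=> mI; rewrite /distrib_fun.
have -> : [set y | I y /\ y <= x] = I `&` `]-oo, x].
  by rewrite set_itvE.
rewrite fineK//; apply: fin_num_measure; exact: measurableI.
Qed.

Lemma distrib_fun_ge0 (R : realType) (I : set R) (mu : probability R R)
    (x : R) : 0 <= distrib_fun I mu x.
Proof. by rewrite fine_ge0. Qed.

Lemma distrib_fun_le1 (R : realType) (I : set R) (mu : probability R R)
    (x : R) : measurable I -> distrib_fun I mu x <= 1.
Proof.
move=> mI; rewrite -lee_fin distrib_funE//.
by apply: probability_le1; exact: measurableI.
Qed.

Lemma distrib_fun_nondecreasing (R : realType) (I : set R)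
    (mu : probability R R) (x y : R) :
  measurable I -> x <= y -> distrib_fun I mu x <= distrib_fun I mu y.
Proof.
move=> mI xy; rewrite -lee_fin !distrib_funE//.
apply: le_measure; rewrite ?inE; try exact: measurableI.
by apply: setIS; apply: subset_itvl; rewrite bnd_simp.
Qed.

(** Right-continuity, stated for lower bounds: the half-lines ]-oo, x + 1/k]
    decrease to ]-oo, x], and mu is continuous from above. *)
Lemma distrib_fun_right_continuous (R : realType) (I : set R)
    (mu : probability R R) (x s : R) :
  measurable I -> (forall y, x < y -> s <= distrib_fun I mu y) ->
  s <= distrib_fun I mu x.
Proof.
move=> mI sF; rewrite -lee_fin distrib_funE//.
rewrite (itvNycEbigcap false) -bigcapIr; last by exists 0%N.
set A := fun k => _.
have mA k : measurable (A k) by exact: measurableI.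
have A0 : (mu (A 0%N) < +oo)%E.
  by rewrite ltey_eq fin_num_measure.
have Ani : {homo A : n m / (n <= m)%N >-> (m <= n)%O}.
  move=> n m nm; rewrite subsetEset; apply: setIS; apply: subset_itvl.
  by rewrite bnd_simp lerD2l lef_pV2 ?posrE// ler_nat ltnS.
have mcapA : measurable (\bigcap_k A k) by exact: bigcapT_measurable.
apply: (cvge_ge _ (nonincreasing_cvg_mu A0 mA mcapA Ani)); near=> k => /=.
rewrite /A -distrib_funE// lee_fin.
by apply: sF; rewrite ltrDl invr_gt0.
Unshelve. all: by end_near. Qed.

Lemma distrib_fun_left (R : realType) (a b : R) (mu : probability R R)
    (x : R) : x < a -> distrib_fun `[a, b] mu x = 0.
Proof.
move=> xa; rewrite /distrib_fun.
rewrite (_ : [set y | _] = set0) ?measure0//.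
apply/seteqP; split=> // y [/=]; rewrite in_itv/= => /andP[ay _] yx.
by have := le_lt_trans (le_trans ay yx) xa; rewrite ltxx.
Qed.

Lemma distrib_fun_right (R : realType) (a b : R) (mu : probability R R)
    (hmu : prob_on `[a, b] mu) : distrib_fun `[a, b] mu b = 1.
Proof.
rewrite /distrib_fun (_ : [set y | _] = `[a, b]%classic) ?hmu//.
apply/seteqP; split=> [y []//|y /= yab]; split=> //.
by move: yab; rewrite in_itv => /andP[].
Qed.

(** * Quantile functions as adjoints of the distribution function *)

Lemma quantile_nondecreasing (R : realType) (I : set R) (m : set R -> \bar R)
    (s t : R) : s <= t -> (quantile I m s <= quantile I m t)%E.
Proof.
move=> st; apply: ereal_sup_le => _ [x /= xs <-]; exists x => //=.
exact: le_trans st.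
Qed.

(** The supremum defining the quantile runs over a down-set, which contains
    every y < x exactly when its supremum is at least x. *)
Lemma le_quantileP (R : realType) (I : set R) (mu : probability R R)
    (t x : R) : measurable I ->
  (x%:E <= quantile I mu t)%E <->
  (forall y, y < x -> distrib_fun I mu y <= t).
Proof.
move=> mI; split=> [xq y yx|Ft].
  have /ereal_sup_gt[_ [z /= Fz <-]] : (y%:E < quantile I mu t)%E.
    by apply: lt_le_trans xq; rewrite lte_fin.
  rewrite lte_fin => yz; apply: le_trans Fz.
  exact/distrib_fun_nondecreasing/ltW.
rewrite leNgt; apply/negP => qx.
have [y [qy yx]] : exists y : R, (quantile I mu t < y%:E)%E /\ y < x.
  move: qx; case: (quantile I mu t) => [q|//|_]; last first.
    by exists (x - 1); rewrite ltNyr ltrBlDr ltrDl ltr01.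
  rewrite lte_fin => qx; exists ((q + x) / 2).
  by rewrite lte_fin midf_lt// midf_lt.
have : (y%:E <= quantile I mu t)%E.
  by apply: ereal_sup_ubound; exists y => //=; exact: Ft.
by rewrite leNgt qy.
Qed.

Lemma quantile_leP (R : realType) (I : set R) (mu : probability R R)
    (t x : R) :
  (quantile I mu t <= x%:E)%E <->
  (forall y, x < y -> t < distrib_fun I mu y).
Proof.
split=> [qx y|tF].
  rewrite !ltNge => /negP xy; apply/negP => Fy; apply: xy.
  rewrite -lee_fin; apply: le_trans qx; apply: ereal_sup_ubound.
  by exists y.
apply: ge_ereal_sup => _ [y /= Fy <-]; rewrite lee_fin leNgt.
by apply/negP => /tF; rewrite ltNge Fy.
Qed.

(** The quantile function is nondecreasing, so its left limit is a supremum
    and exists in the extended reals. *)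
Lemma quantile_leftE (R : realType) (I : set R) (m : set R -> \bar R) (t : R) :
  quantile_left I m t =
  ereal_sup [set quantile I m (t - e) | e in `]0, +oo[].
Proof.
apply: cvg_lim => //.
apply: (nonincreasing_at_right_cvge +oo%O) => // d e _ _ de.
by apply: quantile_nondecreasing; rewrite lerD2l lerN2.
Qed.

(** The left limit turns the strict inequality of [quantile_leP] into a weak
    one, and right-continuity of the distribution function then moves the
    condition from the points y > x to x itself. *)
Lemma quantile_left_leP (R : realType) (I : set R) (mu : probability R R)
    (t x : R) : measurable I ->
  (quantile_left I mu t <= x%:E)%E <-> t <= distrib_fun I mu x.
Proof.
move=> mI; rewrite quantile_leftE; split=> [qx|tF].
  apply: distrib_fun_right_continuous => // y xy.
  apply/ler_addgt0Pr => e e0; rewrite -lerBlDr; apply: ltW.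
  have /quantile_leP : (quantile I mu (t - e) <= x%:E)%E; last exact.
  apply: le_trans qx; apply: ereal_sup_ubound; exists e => //=.
  by rewrite in_itv/= e0.
apply: ge_ereal_sup => z [e /=]; rewrite in_itv/= andbT => e0 <-.
apply/quantile_leP => y /ltW/(distrib_fun_nondecreasing mu mI) Fxy.
by lra.
Qed.

Lemma quantile_ge_left (R : realType) (a b : R) (mu : probability R R) (t : R) :
  0 <= t -> (a%:E <= quantile `[a, b] mu t)%E.
Proof.
move=> t0; apply/le_quantileP; first exact: measurable_itv.
by move=> y ya; rewrite distrib_fun_left.
Qed.

Lemma quantile_le_right (R : realType) (a b : R) (mu : probability R R) (t : R)
    (hmu : prob_on `[a, b] mu) :
  t < 1 -> (quantile `[a, b] mu t <= b%:E)%E.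
Proof.
move=> t1; apply/quantile_leP => y yb; apply: (lt_le_trans t1).
rewrite -(distrib_fun_right hmu).
exact/distrib_fun_nondecreasing/ltW.
Qed.

(** * Discrete measures with prescribed weights *)

Lemma partial_sumS (R : realType) (n : nat) (p : 'I_n -> R) (j : 'I_n) :
  partial_sum p j.+1 = partial_sum p j + p j.
Proof.
rewrite /partial_sum (bigD1 j)//= addrC; congr (_ + _).
by apply: eq_bigl => i; rewrite ltnS ltn_neqAle andbC.
Qed.

(** Sums of weights are compared through their index sets, where only the
    indices of positive weight matter; both partial sums and the values of a
    discrete distribution function are of this form. *)
Lemma ler_sum_support (R : realType) (n : nat) (p : 'I_n -> R)
    (A B : pred 'I_n) : (forall k, 0 <= p k) ->
  (forall k, 0 < p k -> A k -> B k) ->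
  \sum_(k | A k) p k <= \sum_(k | B k) p k.
Proof.
move=> p0 AB; rewrite [leLHS]big_mkcond [leRHS]big_mkcond.
apply: ler_sum => k _; case: ifPn => [Ak|_]; last by case: ifP.
have [pk|pk] := ltP 0 (p k); first by rewrite AB.
by case: ifP.
Qed.

Lemma partial_sum_le (R : realType) (n : nat) (p : 'I_n -> R) (i j : nat) :
  (forall k, 0 <= p k) -> (i <= j)%N -> partial_sum p i <= partial_sum p j.
Proof.
by move=> p0 ij; apply: ler_sum_support => // k _ /leq_trans; apply.
Qed.

Lemma partial_sum_ge0 (R : realType) (n : nat) (p : 'I_n -> R) (i : nat) :
  (forall k, 0 <= p k) -> 0 <= partial_sum p i.
Proof. by move=> p0; apply: sumr_ge0. Qed.

Lemma partial_sum_le1 (R : realType) (n : nat) (p : 'I_n -> R) (i : nat) :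
  Pi p -> partial_sum p i <= 1.
Proof. by move=> [p0 <-]; apply: ler_sum_support. Qed.

Lemma distrib_fun_delta (R : realType) (I : set R) (n : nat)
    (p x : 'I_n -> R) (t : R) : (forall j, I (x j)) ->
  distrib_fun I (delta p x) t = \sum_(j < n | x j <= t) p j.
Proof.
move=> Ix; rewrite /distrib_fun /delta.
under eq_bigr => j _ do rewrite diracE -EFinM.
rewrite sumEFin /= [RHS]big_mkcond; apply: eq_bigr => j _.
case: ifPn => xt; first by rewrite mem_set ?mulr1.
by rewrite memNset ?mulr0// => -[_ /=]; apply/negP.
Qed.

Lemma eq_delta (R : realType) (n : nat) (p x y : 'I_n -> R) :
  (forall j, p j != 0 -> x j = y j) -> delta p x = delta p y.
Proof.
move=> xy; apply/funext => A; apply: eq_bigr => j _.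
by have [->|/xy ->//] := eqVneq (p j) 0; rewrite !mul0e.
Qed.

(** * The Kolmogorov distance to a discrete measure *)

(** The graph of a nondecreasing F stays within K of the step function with
    jumps p j at x j. *)
Definition in_band (R : realType) (F : R -> R) (n : nat) (p x : 'I_n -> R)
    (K : R) : Prop :=
  forall j : 'I_n, 0 < p j ->
    (forall t, t < x j -> F t <= partial_sum p j + K) /\
    partial_sum p j.+1 - K <= F (x j).

Lemma in_bandP (R : realType) (I : set R) (mu : probability R R) (n : nat)
    (p x : 'I_n -> R) (K : R) : measurable I -> Pi p ->
  in_band (distrib_fun I mu) p x K <->
  (forall j : 'I_n, partial_sum p j < partial_sum p j.+1 ->
    (quantile_left I mu (partial_sum p j.+1 - K) <= (x j)%:E)%E /\
    ((x j)%:E <= quantile I mu (partial_sum p j + K))%E).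
Proof.
move=> mI [p0 _]; split=> H j.
  rewrite partial_sumS ltrDl -partial_sumS => /H[Hl Hr].
  by split; [exact/quantile_left_leP|exact/le_quantileP].
move=> pj; have [|Hl Hr] := H j; first by rewrite partial_sumS ltrDl.
by split; [exact/(le_quantileP mu _ _ mI)|exact/(quantile_left_leP mu _ _ mI)].
Qed.

Lemma dK_deltaP (R : realType) (I : set R) (mu : probability R R) (n : nat)
    (p x : 'I_n -> R) (K : R) :
  measurable I -> Pi p -> (forall j, I (x j)) ->
  dK I mu (delta p x) <= K <->
  (forall t, `|distrib_fun I mu t - \sum_(j < n | x j <= t) p j| <= K).
Proof.
move=> mI [p0 p1] Ix; rewrite /dK.
under eq_fun do rewrite distrib_fun_delta//.
split=> [dK t|dK]; last first.
  by apply: ge_sup => [|_ [t _ <-]]; [eexists; exists 0|exact: dK].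
apply: le_trans dK; apply: ub_le_sup; last by exists t.
(* Both functions take values in [0, 1], so 1 bounds their difference. *)
exists 1; move=> _ [s _ <-]; rewrite ler_norml.
have F0 := distrib_fun_ge0 I mu s; have F1 := distrib_fun_le1 mu s mI.
have G0 : 0 <= \sum_(j < n | x j <= s) p j by exact: sumr_ge0.
have G1 : \sum_(j < n | x j <= s) p j <= 1.
  by rewrite -p1; apply: ler_sum_support.
by apply/andP; split; lra.
Qed.

(** For the upper bound on F - G at t, the binding condition is the one at the
    first atom to the right of t, because G t is at least the mass preceding
    it; for the lower bound, it is the one at the last atom not exceeding t.
    When there is no such atom, G t is 1, respectively 0, and the bound is
    trivial. *)
Lemma dK_delta_le (R : realType) (I : set R) (mu : probability R R) (n : nat)
    (p x : 'I_n -> R) (K : R) : measurable I -> Pi p -> Xi I x -> 0 <= K ->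
  dK I mu (delta p x) <= K <-> in_band (distrib_fun I mu) p x K.
Proof.
move=> mI hp [Ix xmono] K0; rewrite dK_deltaP//.
have [p0 p1] := hp.
set F := distrib_fun I mu; set G := fun t => \sum_(j < n | x j <= t) p j.
split=> [FG j pj|band t].
  split=> [t tx|].
    have := FG t; rewrite ler_norml => /andP[_].
    suff : G t <= partial_sum p j by rewrite -/(G t); lra.
    apply: ler_sum_support => // i _ xit; rewrite ltnNge; apply/negP => ji.
    by have := le_lt_trans (le_trans (xmono _ _ ji) xit) tx; rewrite ltxx.
  have := FG (x j); rewrite ler_norml => /andP[].
  suff : partial_sum p j.+1 <= G (x j) by rewrite -/(G (x j)); lra.
  by apply: ler_sum_support => // i _; exact: xmono.
rewrite ler_norml -/(G t); apply/andP; split.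
  pose L : pred 'I_n := fun j => (0 < p j) && (x j <= t).
  have [j0 Pj0|none] := pickP L; last first.
    have := distrib_fun_ge0 I mu t; rewrite -/F.
    suff : G t <= \sum_(j < n | false) p j by rewrite big_pred0_eq; lra.
    apply: ler_sum_support => // j pj xjt.
    by have := none j; rewrite /L pj xjt.
  have [j /andP[pj xjt] jmax] :=
    @arg_maxnP _ j0 L (fun j : 'I_n => val j) Pj0.
  have [_ Fj] := band _ pj.
  have := distrib_fun_nondecreasing mu mI xjt; rewrite -/F.
  suff : G t <= partial_sum p j.+1 by lra.
  apply: ler_sum_support => // i pi0 xit.
  by have := jmax i; rewrite /L pi0 xit => /(_ isT).
pose U : pred 'I_n := fun j => (0 < p j) && (t < x j).
have [j0 Pj0|none] := pickP U; last first.
  have := distrib_fun_le1 mu t mI; rewrite -/F.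
  suff : 1 <= G t by lra.
  rewrite -p1; apply: ler_sum_support => // j pj _.
  by have := none j; rewrite /U pj leNgt => /= ->.
have [j /andP[pj txj] jmin] :=
  @arg_minnP _ j0 U (fun j : 'I_n => val j) Pj0.
have [/(_ _ txj) Fj _] := band _ pj.
suff : partial_sum p j <= G t by lra.
apply: ler_sum_support => // i pi0 ij; rewrite leNgt; apply/negP => txi.
by have := jmin i; rewrite /U pi0 txi leqNgt ij => /(_ isT).
Qed.

(** * The midpoint quantiles are optimal *)

(** Truncating at b makes the entry b wherever the quantile is +oo. *)
Definition clamped_xi (R : realType) (I : set R) (m : set R -> \bar R) (b : R)
    (n : nat) (p : 'I_n -> R) (j : 'I_n) : R :=
  fine (mine (quantile I m ((partial_sum p j + partial_sum p j.+1) / 2)) b%:E).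

Lemma clamped_xiE (R : realType) (a b : R) (mu : probability R R) (n : nat)
    (p : 'I_n -> R) (j : 'I_n) : a <= b -> Pi p ->
  (clamped_xi `[a, b] mu b p j)%:E =
  mine (quantile `[a, b] mu ((partial_sum p j + partial_sum p j.+1) / 2)) b%:E.
Proof.
move=> ab hp; have [p0 _] := hp; rewrite /clamped_xi fineK//.
have := @quantile_ge_left _ a b mu ((partial_sum p j + partial_sum p j.+1) / 2).
rewrite mulr_ge0 ?addr_ge0 ?partial_sum_ge0// => /(_ isT).
case: (quantile _ _ _) => [r _|_|//].
- by rewrite -EFin_min.
- by rewrite minye.
Qed.

Lemma clamped_xi_Xi (R : realType) (a b : R) (mu : probability R R) (n : nat)
    (p : 'I_n -> R) : a <= b -> Pi p ->
  Xi `[a, b] (clamped_xi `[a, b] mu b p).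
Proof.
move=> ab hp; have [p0 _] := hp; split=> [j|i j ij].
  rewrite /= in_itv/= -!lee_fin !clamped_xiE// le_min ge_min !lexx orbT.
  by rewrite andbT quantile_ge_left ?lee_fin ?mulr_ge0 ?addr_ge0 ?partial_sum_ge0.
rewrite -lee_fin !clamped_xiE// le_min !ge_min lexx orbT andbT.
apply/orP; left; apply: quantile_nondecreasing.
by rewrite ler_pM2r// lerD// partial_sum_le.
Qed.

(** A positive weight puts the midpoint level strictly below 1, where the
    quantile does not exceed b. *)
Lemma clamped_xi_xi (R : realType) (a b : R) (mu : probability R R) (n : nat)
    (p : 'I_n -> R) (j : 'I_n) (hmu : prob_on `[a, b] mu) : Pi p ->
  p j != 0 -> clamped_xi `[a, b] mu b p j = xi `[a, b] mu p j.
Proof.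
move=> hp pj; rewrite /clamped_xi /xi min_l// quantile_le_right//.
have [p0 _] := hp; have := p0 j; rewrite le0r (negbTE pj)/= => pj0.
by have := partial_sum_le1 j.+1 hp; rewrite partial_sumS; lra.
Qed.

Lemma Kbullet_clamped (R : realType) (a b : R) (mu : probability R R) (n : nat)
    (p : 'I_n -> R) (hmu : prob_on `[a, b] mu) : Pi p ->
  Kbullet `[a, b] mu p = dK `[a, b] mu (delta p (clamped_xi `[a, b] mu b p)).
Proof.
move=> hp; congr (dK _ _ _); apply: eq_delta => j pj.
by rewrite clamped_xi_xi.
Qed.

(** Let m_j be the midpoint of P_{j-1} and P_j.  The quantile x_j satisfies
    F <= m_j on its left and m_j <= F (x_j).  If t lies between y_j and x_j,
    these and the conditions on y_j give P_j - K <= m_j (when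
    y_j <= t < x_j) or m_j <= P_{j-1} + K (when x_j <= t < y_j); each means
    p_j / 2 <= K, so both hold. *)
Lemma in_band_quantile (R : realType) (I : set R) (mu : probability R R)
    (n : nat) (p x y : 'I_n -> R) (K : R) : measurable I ->
  (forall j, 0 < p j -> (x j)%:E =
     quantile I mu ((partial_sum p j + partial_sum p j.+1) / 2)) ->
  in_band (distrib_fun I mu) p y K -> in_band (distrib_fun I mu) p x K.
Proof.
move=> mI xq band j pj; have [Fl Fr] := band j pj.
have Pj := partial_sumS p j.
have xl : forall t, t < x j ->
    distrib_fun I mu t <= (partial_sum p j + partial_sum p j.+1) / 2.
  by apply/le_quantileP; rewrite ?xq.
have xr : (partial_sum p j + partial_sum p j.+1) / 2 <= distrib_fun I mu (x j).
  apply: distrib_fun_right_continuous => // t xt; apply: ltW; move: t xt.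
  by apply/quantile_leP; rewrite xq.
split=> [t tx|].
  have [ty|yt] := ltP t (y j); first exact: Fl.
  have := distrib_fun_nondecreasing mu mI yt; have := xl _ tx; lra.
have [xy|yx] := ltP (x j) (y j).
  by have := Fl _ xy; lra.
by have := distrib_fun_nondecreasing mu mI yx; lra.
Qed.

Lemma dK_ge0 (R : realType) (I : set R) (mu : probability R R) (n : nat)
    (p x : 'I_n -> R) : measurable I -> Pi p -> (forall j, I (x j)) ->
  0 <= dK I mu (delta p x).
Proof.
move=> mI hp Ix; have /(dK_deltaP _ _ mI hp Ix)/(_ 0) := lexx (dK I mu (delta p x)).
exact: le_trans.
Qed.

Lemma Kbullet_le (R : realType) (a b : R) (mu : probability R R) (n : nat)
    (p y : 'I_n -> R) (hmu : prob_on `[a, b] mu) : a <= b -> Pi p ->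
  Xi `[a, b] y -> Kbullet `[a, b] mu p <= dK `[a, b] mu (delta p y).
Proof.
move=> ab hp Xy; have mI : measurable (`[a, b] : set R) by exact: measurable_itv.
have K0 := dK_ge0 mu mI hp (proj1 Xy).
rewrite Kbullet_clamped//; apply/dK_delta_le => //; first exact: clamped_xi_Xi.
apply: (@in_band_quantile _ _ _ _ _ _ y) => //; last exact/dK_delta_le.
move=> j pj; rewrite clamped_xiE// min_l// quantile_le_right//.
by have := partial_sum_le1 j.+1 hp; rewrite partial_sumS; lra.
Qed.

Theorem theorem5p4 (R : realType) (a b : R) (hab : a < b)
    (mu : probability R R) (hmu : prob_on `[a, b] mu)
    (n : nat) (p : 'I_n -> R) (hp : Pi p) :
  (exists x : 'I_n -> R, best_dK_approx `[a, b] mu p x) /\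
  (forall x : 'I_n -> R, Xi `[a, b] x ->
     (best_dK_approx `[a, b] mu p x <->
      forall j : 'I_n, partial_sum p j < partial_sum p j.+1 ->
        (quantile_left `[a, b] mu
           (partial_sum p j.+1 - Kbullet `[a, b] mu p) <= (x j)%:E)%E /\
        ((x j)%:E <= quantile `[a, b] mu
           (partial_sum p j + Kbullet `[a, b] mu p))%E) /\
     (best_dK_approx `[a, b] mu p x ->
      dK `[a, b] mu (delta p x) = Kbullet `[a, b] mu p)).
Proof.
have mI : measurable (`[a, b] : set R) by exact: measurable_itv.
have Xc := clamped_xi_Xi mu (ltW hab) hp.
have Kmin := fun y => @Kbullet_le _ _ _ mu _ _ y hmu (ltW hab) hp.
have Kc := Kbullet_clamped hmu hp.
have K0 : 0 <= Kbullet `[a, b] mu p by rewrite Kc; apply: dK_ge0 => //; case: Xc.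
have bestE x : best_dK_approx `[a, b] mu p x ->
    dK `[a, b] mu (delta p x) = Kbullet `[a, b] mu p.
  move=> [Xx xmin]; apply/eqP; rewrite eq_le Kmin// andbT Kc; exact: xmin.
split.
  exists (clamped_xi `[a, b] mu b p); split=> // y Xy.
  by rewrite -Kc Kmin.
move=> x Xx; split; last exact: bestE.
rewrite -in_bandP// -dK_delta_le//; split=> [/bestE ->//|xK].
by split=> // y /Kmin; exact: le_trans.
Qed.
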